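(* Let $(B,+,\circ)$ be a left $RG$-semibrace and let $r_B$ be the solution associated with $B$. Then $r_B$ is cubic, i.e., $r_B^3=r_B$, if and only if the group $(G,+)$, where $G=B+0$, is abelian. In particular, $r_B$ is idempotent (i.e., $r_B^2=r_B$) if and only if $G=\{0\}$, namely, $(B,+)=(E,+)$ is a right zero semigroup.
   Context: A right group is a non-empty semigroup $(S,\cdot)$ such that for all $a,b\in S$ there is a unique $x\in S$ with $a\cdot x=b$. A right zero semigroup is a semigroup with $a\cdot b=b$ for all $a,b$. A left $RG$-semibrace is a triplet $(B,+,\circ)$ where $+,\circ$ are binary operations on the set $B$ such that $(B,+)$ and $(B,\circ)$ are both right groups and $a\circ(b+c)=a\circ b+(-a+a\circ c)$ for all $a,b,c\in B$, where $-a+a\circ c$ denotes the unique $x\in B$ such that $a+x=a\circ c$. Fix an idempotent $0$ of $(B,\circ)$ (it is then also idempotent in $(B,+)$). Let $E$ be the set of all idempotents of $(B,+)$. The set $G=B+0=\{b+0\mid b\in B\}$ is a subgroup of $(B,+)$ with identity $0$; put $g_b=b+0\in G$, and let $-g_b$ be its inverse in $(G,+)$. The set $H=B\circ 0$ is a subgroup of $(B,\circ)$ with identity $0$; put $h_b=b\circ 0\in H$, and let $h_b^-$ be its inverse in $(H,\circ)$. For $a,b\in B$ put $\lambda_a(b)=-g_a+a\circ b$ (the unique $x\in B$ with $a+x=a\circ b$) and $\rho_b(a)=h^-_{\lambda_a(b)}\circ a\circ b$. The solution associated with $B$ is the map $r_B:B\times B\to B\times B$, $r_B(a,b)=(\lambda_a(b),\rho_b(a))$.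 Powers of $r_B$ are taken with respect to composition. *)

(* Defs.v *)
From mathcomp Require Import all_boot.
From mathcomp Require Import boolp classical_sets.

Set Implicit Arguments.
Unset Strict Implicit.
Unset Printing Implicit Defensive.

Local Open Scope classical_set_scope.

Definition right_group (T : Type) (op : T -> T -> T) : Prop :=
  [/\ inhabited T, associative op & forall a b, exists! x, op a x = b].

Definition right_zero_semigroup (T : Type) (op : T -> T -> T) : Prop :=
  associative op /\ forall a b, op a b = b.

(* A chosen x satisfying P, or the junk value x0 if there is none; this is used
   below only where such an x exists and is unique.  [{classic T}] is T itself
   with the choice structure that [xget] requires. *)
Definition the (T : Type) (x0 : T) (P : set T) : T :=
  @xget {classic T} x0 P.

(* The unique x such that op a x = b, that is -a + b in additive notation. *)
Definition ldiv (T : Type) (op : T -> T -> T) (a b : T) : T :=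
  the a [set x | op a x = b].

(* The inverse of x in the group (K, op) with identity e. *)
Definition group_inv (T : Type) (op : T -> T -> T) (K : set T) (e x : T) : T :=
  the e [set y | [/\ K y, op x y = e & op y x = e]].

Definition idempotents (T : Type) (op : T -> T -> T) : set T :=
  [set e | op e e = e].

Record left_RG_semibrace := LeftRGSemibrace {
  carrier :> Type;
  add : carrier -> carrier -> carrier;
  circ : carrier -> carrier -> carrier;
  add_right_group : right_group add;
  circ_right_group : right_group circ;
  circ_add : forall a b c : carrier,
    circ a (add b c) = add (circ a b) (ldiv add a (circ a c)) }.

Declare Scope semibrace_scope.
Delimit Scope semibrace_scope with SB.
Notation "a + b" := (add a b) : semibrace_scope.
Notation "a ∘ b" := (circ a b) (at level 40, left associativity)
  : semibrace_scope.
Local Open Scope semibrace_scope.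

(* In what follows, z is the chosen idempotent of (B, circ), written 0 in
   mathematical notation. *)

Definition gproj (B : left_RG_semibrace) (z b : B) : B := b + z.

Definition Gset (B : left_RG_semibrace) (z : B) : set B := range (gproj z).

Definition hproj (B : left_RG_semibrace) (z b : B) : B := b ∘ z.

Definition Hset (B : left_RG_semibrace) (z : B) : set B := range (hproj z).

Definition lambda (B : left_RG_semibrace) (z a b : B) : B :=
  group_inv (@add B) (Gset z) z (gproj z a) + a ∘ b.

Definition rho (B : left_RG_semibrace) (z b a : B) : B :=
  group_inv (@circ B) (Hset z) z (hproj z (lambda z a b)) ∘ a ∘ b.

Definition solution (B : left_RG_semibrace) (z : B) (p : B * B) : B * B :=
  (lambda z p.1 p.2, rho z p.2 p.1).

(* Main.v *)
Require Import Defs.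
From mathcomp Require Import all_boot.
From mathcomp Require Import boolp classical_sets.

(** The map [solution z] preserves the product [m = a ∘ b].  Indeed
    [solution z (a, b)] is the pair [(u, v)] determined by
    [a + u = m = u ∘ v], and once [m] is known such a pair is determined by
    its first component (lemma [solutionP]).  Iterating the solution on the
    pairs of product [m] is therefore iterating the map [x |-> -x + m] on
    [(B, +)], and since [a ∘ -] is onto, [m] can be any element, whatever [a]
    is.  The multiplicative structure thus disappears:
    - [r^3 = r] says that [y + w = x + y] implies [w + y = x + y]
      (lemma [solution_cubicP]);
    - [r^2 = r] says that [y + y = x + y] for all [x], [y]
      (lemma [solution_idempotentP]).

    What remains is a computation in the right group [(B, +)], where [z] is a
    left identity, so that [x + y] depends on [x] only through its image
    [x + z] in [G].  The first condition says that [w = -y + x + y] and [x]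
    have the same image in [G], that is, conjugation in [G] is trivial.  The
    second one, at [y = z], says that every [x + z] is [z]. *)

Local Open Scope classical_set_scope.
Local Open Scope semibrace_scope.

Section RightGroup.

Context {T : Type} {op : T -> T -> T} (opG : right_group op).

Lemma right_group_assoc : associative op.
Proof. by case: opG. Qed.

Lemma right_group_solve (a b : T) : exists x, op a x = b.
Proof. by case: opG => _ _ /(_ a b) [x [xP _]]; exists x. Qed.

Lemma right_group_cancel (a x y : T) : op a x = op a y -> x = y.
Proof.
case: opG => _ _ /(_ a (op a y)) [t [_ tP]] xy.
by rewrite -(tP x xy) -(tP y erefl).
Qed.

Lemma right_group_idem_id (e : T) : op e e = e -> forall x, op e x = x.
Proof.
by move=> ee x; apply: (@right_group_cancel e); rewrite right_group_assoc ee.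
Qed.

(** The chosen inverse is a genuine one because [S e] is a group: every
    [x] in [S e] has a right inverse [y] in [S e], so does [y], and a right
    inverse of an element having itself a right inverse is two-sided. *)
Lemma group_inv_right (e a : T) : op e e = e ->
  op (op a e) (group_inv op (range (op^~ e)) e (op a e)) = e.
Proof.
move=> ee; set x := op a e.
set Q := [set y | [/\ range (op^~ e) y, op x y = e & op y x = e]].
suff [y Qy] : exists y, Q y.
  by have [] : Q (group_inv op (range (op^~ e)) e x)
    by exact: (@xgetI {classic T} e Q y Qy).
have [t xt] := right_group_solve x e.
have xy : op x (op t e) = e by rewrite right_group_assoc xt.
set y := op t e in xy *.
have xe : op x e = x by rewrite -right_group_assoc ee.
have ye : op y e = y by rewrite -right_group_assoc ee.
have [y' yy'] := right_group_solve y e.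
exists y; split=> //.
by rewrite -{1}xe -{1}yy' (right_group_assoc x) xy right_group_assoc ye.
Qed.

End RightGroup.

Section Solution.

Context {B : left_RG_semibrace} {z : B} (hz : idempotents (@circ B) z).

Let addA := right_group_assoc (add_right_group B).
Let addI := right_group_cancel (add_right_group B).
Let circA := right_group_assoc (circ_right_group B).
Let circI := right_group_cancel (circ_right_group B).

Lemma circ_idem_left_id (x : B) : z ∘ x = x.
Proof. exact: right_group_idem_id (circ_right_group B) z hz x. Qed.

(** Idempotents of [∘] are idempotents of [+]: as [z] is a left identity for
    [∘], the compatibility axiom with left
    factor [z] reads [b + c = b + (-z + c)]; cancel [b]. *)
Lemma add_idem_left_id (x : B) : z + x = x.
Proof.
have [y zy] := right_group_solve (add_right_group B) z x.
have ldivE : z + ldiv (@add B) z x = x.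
  exact: (@xgetI {classic B} z [set t | z + t = x] y zy).
have := circ_add z z x; rewrite !circ_idem_left_id => /addI xE.
by rewrite {1}xE.
Qed.

Lemma lambda_spec (a b : B) : a + lambda z a b = a ∘ b.
Proof.
have zz : z + z = z by exact: add_idem_left_id.
have inv : gproj z a + group_inv (@add B) (Gset z) z (gproj z a) = z.
  exact: group_inv_right (add_right_group B) z a zz.
by rewrite /lambda -[X in a + X]add_idem_left_id !addA -/(gproj z a) inv
  add_idem_left_id.
Qed.

Lemma rho_spec (a b : B) : lambda z a b ∘ rho z b a = a ∘ b.
Proof.
set u := lambda z a b.
have inv : hproj z u ∘ group_inv (@circ B) (Hset z) z (hproj z u) = z.
  exact: group_inv_right (circ_right_group B) z u hz.
by rewrite /rho -/u -[X in u ∘ (X ∘ _ ∘ _)]circ_idem_left_id !circA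
  -/(hproj z u) inv circ_idem_left_id.
Qed.

(** The defining formulas only serve to solve two equations: [lambda] is
    the left quotient of [a ∘ b] by [a] in [(B, +)], and [rho] the left
    quotient of [a ∘ b] by [lambda] in [(B, ∘)].  Uniqueness of left
    quotients gives the converse. *)
Lemma solutionP {a b u v : B} :
  solution z (a, b) = (u, v) <-> a + u = a ∘ b /\ u ∘ v = a ∘ b.
Proof.
split=> [[<- <-]|[au uv]]; first by rewrite lambda_spec rho_spec.
have uE : lambda z a b = u by apply: (@addI a); rewrite lambda_spec.
congr (_, _) => //=.
by apply: (@circI u); rewrite uv -uE rho_spec.
Qed.

(** Each instance [x], [y], [w] of the right-hand side is an orbit of the
    solution: with [m = x + y], the first components are [x], then
    [y = -x + m], then [w = -y + m], and the next one is again [y] exactly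
    when [w + y = m]. *)
Lemma solution_cubicP :
  iter 3 (solution z) =1 solution z <->
  (forall x y w : B, y + w = x + y -> w + y = x + y).
Proof.
split=> [cubic x y w yw|H [a b] /=].
  (* Second components giving all three pairs the product [x + y]. *)
  have [b xb] := right_group_solve (circ_right_group B) x (x + y).
  have [c yc] := right_group_solve (circ_right_group B) y (x + y).
  have [d wd] := right_group_solve (circ_right_group B) w (x + y).
  have s1 : solution z (x, b) = (y, c) by apply/solutionP; rewrite xb.
  have s2 : solution z (y, c) = (w, d) by apply/solutionP; rewrite yc.
  have := cubic (x, b); rewrite /= s1 s2 => /solutionP[-> _].
  exact: wd.
case s1: (solution z (a, b)) => [u v].
case s2: (solution z (u, v)) => [u' v'].
have [au uv] := solutionP.1 s1.
have [uu' uv'] := solutionP.1 s2.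
apply/solutionP; rewrite uv'; split=> //.
by rewrite uv -au; apply: H; rewrite uu' uv au.
Qed.

Lemma solution_idempotentP :
  iter 2 (solution z) =1 solution z <-> (forall x y : B, y + y = x + y).
Proof.
split=> [idem x y|H [a b] /=].
  have [b xb] := right_group_solve (circ_right_group B) x (x + y).
  have [c yc] := right_group_solve (circ_right_group B) y (x + y).
  have s1 : solution z (x, b) = (y, c) by apply/solutionP; rewrite xb.
  have := idem (x, b); rewrite /= s1 => /solutionP[-> _].
  exact: yc.
case s1: (solution z (a, b)) => [u v].
have [au uv] := solutionP.1 s1.
by apply/solutionP; rewrite uv -au.
Qed.

Lemma add_gproj (x y : B) : x + z + y = x + y.
Proof. by rewrite -addA add_idem_left_id. Qed.

Lemma Gset_add_idem {x : B} : Gset z x -> x + z = x.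
Proof. by case=> b _ <-; rewrite /gproj add_gproj. Qed.

(** The hypothesis [y + w = x + y] makes [w] the conjugate [-y + x + y], while
    [w + y = x + y] says that [w] and [x] have the same image in [G]. *)
Lemma Gset_abelianP :
  (forall x y w : B, y + w = x + y -> w + y = x + y) <->
  (forall x y : B, Gset z x -> Gset z y -> x + y = y + x).
Proof.
split=> [H x y Gx Gy|abel x y w yw].
  have [w yw] := right_group_solve (add_right_group B) y (x + y).
  have wy := H x y w yw.
  have [y' yy'] := right_group_solve (add_right_group B) y z.
  have wx : w + z = x + z by rewrite -yy' !addA wy.
  by rewrite -(Gset_add_idem Gy) addA -yw -addA wx (Gset_add_idem Gx) add_gproj.
have Gx : Gset z (x + z) by exists x.
have Gy : Gset z (y + z) by exists y.
suff wx : w + z = x + z by rewrite -(add_gproj w) wx add_gproj.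
apply: (@addI (y + z)); rewrite -(abel _ _ Gx Gy).
by rewrite !add_gproj !addA yw.
Qed.

Lemma Gset_trivialP : Gset z = [set z] <-> (forall x y : B, x + y = y).
Proof.
split=> [G0 x y|add0].
  have xz : x + z = z by have : Gset z (x + z) by [exists x]; rewrite G0.
  by rewrite -add_gproj xz add_idem_left_id.
apply/seteqP; split=> x /=; first by case=> b _ <-; rewrite /gproj add0.
by move=> ->; exists z => //; rewrite /gproj add0.
Qed.

End Solution.

Theorem corollary3p10 (B : left_RG_semibrace) (z : B)
    (hz : idempotents (@circ B) z) :
  (iter 3 (solution z) =1 solution z <->
     (forall x y : B, Gset z x -> Gset z y -> x + y = y + x)) /\
  (iter 2 (solution z) =1 solution z <-> Gset z = [set z]) /\
  (Gset z = [set z] <->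
     (idempotents (@add B) = [set: B] /\ right_zero_semigroup (@add B))).
Proof.
split; first exact: iff_trans (solution_cubicP hz) (Gset_abelianP hz).
split.
  apply: (iff_trans (solution_idempotentP hz)).
  apply: iff_trans (iff_sym (Gset_trivialP hz)).
  split=> [H x y|add0 x y]; last by rewrite !add0.
  have xz : x + z = z by rewrite -H add_idem_left_id.
  by rewrite -(add_gproj hz) xz add_idem_left_id.
apply: (iff_trans (Gset_trivialP hz)).
split=> [add0|[_ [_ add0]]]; last exact: add0.
split; first by apply/seteqP; split=> x //= _; apply: add0.
by split=> //; apply: right_group_assoc (add_right_group B).
Qed.
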